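(* Fix real numbers $c_0>0$, $x_0<x_\ast$ and $\omega_{\min}<\omega_{\max}$. Let $c$ and $\tilde c$ be two admissible wave speeds (as defined in the context, possibly with different numbers of jump points) relative to the same data $(c_0,x_0,x_\ast)$, and let $u$ and $\tilde u$ be the corresponding outgoing solutions of the one-dimensional Helmholtz equation with point source at $x_0$. If $$u(x_\ast,\omega)=\tilde u(x_\ast,\omega)\qquad\text{for all }\omega\in(\omega_{\min},\omega_{\max}),\ \omega\neq 0,$$ then $c=\tilde c$ as functions on $\mathbb{R}$. That is, the measured data $d(\omega)=u(x_\ast,\omega)$, $\omega_{\min}<\omega<\omega_{\max}$, uniquely determines $c$.
   Context: Admissible wave speed relative to $(c_0,x_0,x_\ast)$: a step function $c:\mathbb{R}\to(0,\infty)$ of the form $$c(x)=c_0\chi_{(-\infty,x_1]}(x)+\Bigl(\sum_{j=1}^{n-1}c_j\chi_{(x_j,x_{j+1}]}(x)\Bigr)+c_n\chi_{(x_n,\infty)}(x),$$ where $n\ge 1$, $x_0<x_\ast<x_1<x_2<\cdots<x_n$ and $c_1,\dots,c_n>0$ (consecutive values $c_{j-1},c_j$ are allowed to coincide). Here $\chi_E$ is the indicator function of $E$. Outgoing solution: for real $\omega\neq 0$, $u(\cdot,\omega):\mathbb{R}\to\mathbb{C}$ is the unique function that is continuous on $\mathbb{R}$, $C^1$ on $\mathbb{R}\setminus\{x_0\}$, satisfies $$u''+\kappa^2u=-\delta(x-x_0),\qquad \kappa(x)=\omega/c(x),$$ in the sense of distributions in $x$ (primes denote derivatives in $x$; in particular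 $u'$ jumps by $-1$ at $x_0$), and satisfies the outgoing radiation condition: $u(x,\omega)$ is a constant multiple of $e^{-i\omega x/c_0}$ for $x<x_0$ and a constant multiple of $e^{i\omega x/c_n}$ for $x>x_n$. *)

(* Defs.v *)
From Stdlib Require Import Reals Lra Lia.
From Coquelicot Require Import Coquelicot.
Open Scope R_scope.

(* Complex-valued functions of a real
   variable are differentiated and integrated in [C_R_NormedModule], i.e. with
   C regarded as a real normed space. *)

Definition chi_le (b x : R) : R := if Rle_dec x b then 1 else 0.
Definition chi_gt (a x : R) : R := if Rlt_dec a x then 1 else 0.
Definition chi_Ioc (a b x : R) : R :=
  if Rlt_dec a x then (if Rle_dec x b then 1 else 0) else 0.

(* An admissible wave speed relative to (c0, x0, xs), given by its n jump
   points x_1 < ... < x_n and its values c_1, ..., c_n.  Only the indices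
   1, ..., n of [ws_x] and [ws_c] are meaningful; in particular [ws_x 0] and
   [ws_c 0] are junk and unrelated to the parameters x0 and c0.  The
   hypotheses 0 < c0 and x0 < xs on the parameters are not part of the
   record. *)
Record wave_speed (c0 x0 xs : R) : Type := {
  ws_n : nat;
  ws_x : nat -> R;
  ws_c : nat -> R;
  ws_n_pos : (1 <= ws_n)%nat;
  ws_x_first : xs < ws_x 1%nat;
  ws_x_incr : forall j : nat,
    (1 <= j)%nat -> (j < ws_n)%nat -> ws_x j < ws_x (S j);
  ws_c_pos : forall j : nat,
    (1 <= j)%nat -> (j <= ws_n)%nat -> 0 < ws_c j
}.
Arguments ws_n {c0 x0 xs} _.
Arguments ws_x {c0 x0 xs} _ _.
Arguments ws_c {c0 x0 xs} _ _.

(* The sum is empty when n = 1. *)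
Definition speed {c0 x0 xs : R} (c : wave_speed c0 x0 xs) (x : R) : R :=
  c0 * chi_le (ws_x c 1%nat) x
  + sum_n_m (fun j : nat => ws_c c j * chi_Ioc (ws_x c j) (ws_x c (S j)) x)
      1 (ws_n c - 1)
  + ws_c c (ws_n c) * chi_gt (ws_x c (ws_n c)) x.

(* e^{it} for real t. *)
Definition Cexpi (t : R) : C := (cos t, sin t).

Definition smooth (phi : R -> R) : Prop :=
  forall (k : nat) (x : R), ex_derive_n phi k x.

(* u'' + kappa^2 u = - delta(x - x0) in the sense of distributions, with
   kappa = omega / c.  Real-valued test functions suffice for a complex-valued
   u, by linearity; [a, b] is any compact interval containing the support of
   the test function. *)
Definition helmholtz_source (c : R -> R) (x0 omega : R) (u : R -> C) : Prop :=
  forall (phi : R -> R) (a b : R),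
    a < b -> smooth phi ->
    (forall x : R, ~ (a <= x <= b) -> phi x = 0) ->
    is_RInt (V := C_R_NormedModule)
      (fun x : R => (u x * RtoC (Derive_n phi 2 x)
                     + RtoC ((omega / c x) ^ 2) * u x * RtoC (phi x))%C)
      a b (RtoC (- phi x0)).

Definition C1_except (x0 : R) (u : R -> C) : Prop :=
  exists du : R -> C,
    forall x : R, x <> x0 ->
      is_derive (V := C_R_NormedModule) u x (du x) /\
      continuous (U := C_R_NormedModule) du x.

Definition outgoing_radiation {c0 x0 xs : R} (c : wave_speed c0 x0 xs)
    (omega : R) (u : R -> C) : Prop :=
  (exists A : C, forall x : R, x < x0 ->
     u x = (A * Cexpi (- (omega * x / c0)))%C) /\
  (exists B : C, forall x : R, ws_x c (ws_n c) < x ->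
     u x = (B * Cexpi (omega * x / ws_c c (ws_n c)))%C).

Definition outgoing_solution {c0 x0 xs : R} (c : wave_speed c0 x0 xs)
    (omega : R) (u : R -> C) : Prop :=
  (forall x : R, continuous (U := C_R_NormedModule) u x) /\
  C1_except x0 u /\
  helmholtz_source (speed c) x0 omega u /\
  outgoing_radiation c omega u.

(* Main.v *)
Require Import Defs.
From Stdlib Require Import Reals Lra Lia List FunctionalExtensionality.
From Coquelicot Require Import Coquelicot.
Import ListNotations.
Open Scope R_scope.

(** The outgoing condition on the left and the known speed near x0 turn the
    datum u(xs) into the Cauchy data (u, u') at xs.  On the right, these are
    proportional to a pair (P, i omega Q) of finite exponential sums in omega
    determined by the medium, so equal data give P Q' = Q P' on an interval.
    Linear independence of exponentials makes this an identity between formal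
    sums, hence it also holds at imaginary frequencies omega = i s.  There P
    and Q are positive and P / Q tends to the speed of the first layer as s goes
    to infinity.  Hence both media start with the same speed; the thinner of the
    two first layers can be peeled off both, and the argument repeats.  The ODE
    facts come from testing the distributional equation against a cutoff times
    a solution v of v'' + k^2 v = 0, which gives the Wronskian of u and v. *)

(** * Exponential sums *)

(* An exponential sum [sum a_k e^(i w t_k)] is stored as the list of the pairs
   (a_k, t_k); [ev h] replaces every exponential by the value h(t_k). *)
Definition ev (h : R -> R) (L : list (R * R)) : R :=
  fold_right (fun m acc => fst m * h (snd m) + acc) 0 L.

Lemma ev_ext (h h' : R -> R) (L : list (R * R)) :
  (forall t, h t = h' t) -> ev h L = ev h' L.
Proof.
  intros H; induction L as [|[a t] L IH]; simpl; [easy|].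
  now rewrite H, IH.
Qed.

Lemma ev_lin (x y : R) (h h' : R -> R) (L : list (R * R)) :
  ev (fun t => x * h t + y * h' t) L = x * ev h L + y * ev h' L.
Proof. induction L as [|[a t] L IH]; simpl; [ring|]. rewrite IH; ring. Qed.

Lemma ev_scal (x : R) (h : R -> R) (L : list (R * R)) :
  ev (fun t => x * h t) L = x * ev h L.
Proof. induction L as [|[a t] L IH]; simpl; [ring|]. rewrite IH; ring. Qed.

Lemma is_derive_ev (h h' : R -> R -> R) (L : list (R * R)) (w : R) :
  (forall t, is_derive (fun w => h w t) w (h' w t)) ->
  is_derive (fun w => ev (h w) L) w (ev (h' w) L).
Proof.
  intros H; induction L as [|[a t] L IH]; simpl.
  - apply @is_derive_const.
  - apply @is_derive_plus; [|easy].
    now apply is_derive_scal.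
Qed.

Lemma is_derive_zero_on (f : R -> R) (a b w l : R) :
  (forall w, a < w < b -> f w = 0) -> a < w < b -> is_derive f w l -> l = 0.
Proof.
  intros H Hw Hf.
  assert (Hd : is_derive f w 0).
  { apply (is_derive_ext_loc (fun _ => 0)).
    - exists (mkposreal (Rmin (w - a) (b - w)) ltac:(apply Rmin_pos; lra)).
      intros y Hy. symmetry; apply H.
      unfold ball in Hy; simpl in Hy; unfold AbsRing_ball, abs, minus, plus, opp in Hy;
        simpl in Hy.
      apply Rabs_def2 in Hy.
      pose proof (Rmin_l (w - a) (b - w)); pose proof (Rmin_r (w - a) (b - w)); lra.
    - apply @is_derive_const. }
  rewrite <- (is_derive_unique _ _ _ Hf). now apply is_derive_unique.
Qed.

(* Combining the hypothesis with its derivative in w gives the weight an extra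
   factor (t - t1), which removes the frequency t1 of the first term. *)
Lemma ev_weighted_zero (a b : R) (L : list (R * R)) (r : R -> R) :
  a < b ->
  (forall w, a < w < b -> ev (fun t => r t * cos (w * t)) L = 0
                       /\ ev (fun t => r t * sin (w * t)) L = 0) ->
  forall h, ev (fun t => r t * h t) L = 0.
Proof.
  intros Hab; revert r.
  induction L as [|[a1 t1] L IH]; intros r H h; [easy|].
  set (L1 := (a1, t1) :: L) in *.
  assert (H1 : forall g, ev (fun t => r t * (t - t1) * g t) L = 0).
  { apply IH. intros w Hw.
    assert (Ec : forall g, ev (fun t => r t * (t - t1) * g t) L
                   = ev (fun t => r t * t * g t) L1 - t1 * ev (fun t => r t * g t) L1).
    { intros g.
      (* The new weight vanishes at [t1], so the head term can be put back for free, and the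
         vanishing of sums over [L1] becomes usable. *)
      transitivity (ev (fun t => r t * (t - t1) * g t) L1); [simpl; ring|].
      replace (ev (fun t => r t * t * g t) L1 - t1 * ev (fun t => r t * g t) L1)
        with (1 * ev (fun t => r t * t * g t) L1 + (- t1) * ev (fun t => r t * g t) L1)
        by ring.
      rewrite <- ev_lin. apply ev_ext; intros; ring. }
    destruct (H w Hw) as [Hc Hs].
    rewrite !Ec, Hc, Hs. split.
    - rewrite (is_derive_zero_on (fun w => ev (fun t => r t * sin (w * t)) L1) a b w
        (ev (fun t => r t * t * cos (w * t)) L1)); [ring| |easy|].
      + intros; now apply H.
      + apply (is_derive_ev (fun w t => r t * sin (w * t)) (fun w t => r t * t * cos (w * t))).
        intros; auto_derive; [easy|ring].
    - enough (- 1 * ev (fun t => r t * t * sin (w * t)) L1 = 0) by lra.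
      rewrite <- ev_scal.
      apply (is_derive_zero_on (fun w => ev (fun t => r t * cos (w * t)) L1) a b w);
        [intros; now apply H|easy|].
      apply (is_derive_ev (fun w t => r t * cos (w * t))
               (fun w t => -1 * (r t * t * sin (w * t)))).
      intros; auto_derive; [easy|ring]. }
  (* Feeding the difference quotient of [g] at [t1] into [H1] cancels the factor [t - t1]. Its value
     at [t = t1] is arbitrary, because the weight is zero there. *)
  assert (H2 : forall g, ev (fun t => r t * g t) L1 = g t1 * ev r L1).
  { intros g.
    specialize (H1 (fun t => if Req_EM_T t t1 then 0 else (g t - g t1) / (t - t1))).
    rewrite (ev_ext _ (fun t => 1 * (r t * g t) + (- g t1) * r t)) in H1.
    - rewrite ev_lin in H1. simpl. simpl in H1. lra.
    - intros t; destruct (Req_EM_T t t1) as [->|Ht]; [ring|]. field; lra. }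
  rewrite H2.
  assert (Hw : a < (a + b) / 2 < b) by lra.
  destruct (H _ Hw) as [Hc Hs]. rewrite (H2 (fun t => cos ((a + b) / 2 * t))) in Hc.
  rewrite (H2 (fun t => sin ((a + b) / 2 * t))) in Hs.
  pose proof (sin2_cos2 ((a + b) / 2 * t1)) as T. unfold Rsqr in T.
  set (z := (a + b) / 2 * t1) in *.
  (* Cosine and sine never vanish together, so one frequency of the interval already forces the
     total weight [ev r L1] to be zero. *)
  assert (E : ev r L1 = sin z * (sin z * ev r L1) + cos z * (cos z * ev r L1)).
  { transitivity ((sin z * sin z + cos z * cos z) * ev r L1); [rewrite T|]; ring. }
  rewrite E, Hc, Hs; ring.
Qed.

Definition evc (w : R) (L : list (R * R)) : C :=
  (ev (fun t => cos (w * t)) L, ev (fun t => sin (w * t)) L).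

(** This takes the place of analytic continuation: since [h] is arbitrary, an identity on a real
    interval can be evaluated at imaginary frequencies. *)
Lemma ev_zero (a b : R) (L : list (R * R)) :
  a < b -> (forall w, a < w < b -> evc w L = 0%C) -> forall h, ev h L = 0.
Proof.
  intros Hab H h.
  rewrite (ev_ext h (fun t => 1 * h t)) by (intros; ring).
  apply (ev_weighted_zero a b _ (fun _ => 1) Hab).
  intros w Hw. specialize (H w Hw). injection H as Hc Hs.
  split; rewrite ev_scal; [rewrite Hc | rewrite Hs]; ring.
Qed.

(** * Formal operations on exponential sums *)

Definition escale (x : R) : list (R * R) -> list (R * R) :=
  map (fun m => (x * fst m, snd m)).

Definition eshift (y : R) : list (R * R) -> list (R * R) :=
  map (fun m => (fst m, y + snd m)).

Fixpoint emul (L L' : list (R * R)) : list (R * R) :=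
  match L with
  | [] => []
  | m :: L => escale (fst m) (eshift (snd m) L') ++ emul L L'
  end.

Lemma ev_app (h : R -> R) (L L' : list (R * R)) : ev h (L ++ L') = ev h L + ev h L'.
Proof. induction L as [|m L IH]; simpl; [ring|]. rewrite IH; ring. Qed.

Lemma ev_escale (h : R -> R) (x : R) (L : list (R * R)) : ev h (escale x L) = x * ev h L.
Proof. induction L as [|m L IH]; simpl; [ring|]. rewrite IH; ring. Qed.

Lemma ev_eshift (h : R -> R) (y : R) (L : list (R * R)) :
  ev h (eshift y L) = ev (fun t => h (y + t)) L.
Proof. induction L as [|m L IH]; simpl; [easy|]. now rewrite IH. Qed.

Lemma ev_emul (h : R -> R) (L L' : list (R * R)) :
  (forall t t', h (t + t') = h t * h t') -> ev h (emul L L') = ev h L * ev h L'.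
Proof.
  intros H; induction L as [|m L IH]; simpl; [ring|].
  rewrite ev_app, ev_escale, ev_eshift, IH.
  rewrite (ev_ext _ (fun t => h (snd m) * h t)) by (intros; apply H).
  rewrite ev_scal; ring.
Qed.

Lemma evc_app (w : R) (L L' : list (R * R)) : evc w (L ++ L') = (evc w L + evc w L')%C.
Proof. unfold evc; now rewrite !ev_app. Qed.

Lemma evc_escale (w x : R) (L : list (R * R)) : evc w (escale x L) = (RtoC x * evc w L)%C.
Proof. unfold evc; rewrite !ev_escale; unfold Cmult, RtoC; simpl; f_equal; ring. Qed.

Lemma evc_eshift (w y : R) (L : list (R * R)) :
  evc w (eshift y L) = (Cexpi (w * y) * evc w L)%C.
Proof.
  unfold evc, Cexpi, Cmult; simpl. rewrite !ev_eshift. f_equal.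
  - rewrite (ev_ext _ (fun t => cos (w * y) * cos (w * t) + (- sin (w * y)) * sin (w * t))).
    + rewrite ev_lin; ring.
    + intros t. rewrite Rmult_plus_distr_l, cos_plus; ring.
  - rewrite (ev_ext _ (fun t => cos (w * y) * sin (w * t) + sin (w * y) * cos (w * t))).
    + rewrite ev_lin; ring.
    + intros t. rewrite Rmult_plus_distr_l, sin_plus; ring.
Qed.

(** Cosine and sine are not multiplicative one by one, so [ev_emul] does not apply; the complex
    exponential has to be treated as a whole. *)
Lemma evc_emul (w : R) (L L' : list (R * R)) : evc w (emul L L') = (evc w L * evc w L')%C.
Proof.
  induction L as [|[a t] L IH]; simpl.
  - unfold evc, Cmult; simpl; f_equal; ring.
  - rewrite evc_app, evc_escale, evc_eshift, IH.
    unfold evc, Cexpi, Cmult, Cplus, RtoC; simpl; f_equal; ring.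
Qed.

(** * Layered media and their response *)

(* [Half c] is a half-line of speed c; [Layer c d M] is an interval of length d
   and speed c followed on its right by M. *)
Inductive medium : Type :=
| Half : R -> medium
| Layer : R -> R -> medium -> medium.

Fixpoint wf (M : medium) : Prop :=
  match M with
  | Half c => 0 < c
  | Layer c d M => 0 < c /\ 0 < d /\ wf M
  end.

Definition lead (M : medium) : R := match M with Half c => c | Layer c _ _ => c end.

Fixpoint terminal (M : medium) : R :=
  match M with Half c => c | Layer _ _ M => terminal M end.

Fixpoint layers (M : medium) : nat :=
  match M with Half _ => 0%nat | Layer _ _ M => S (layers M) end.

(* The speed at x when the left end of M is at y. *)
Fixpoint mspeed (y : R) (M : medium) (x : R) : R :=
  match M with
  | Half c => c
  | Layer c d M => if Rle_dec x (y + d) then c else mspeed (y + d) M x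
  end.

(* The values, at the left end of the medium, of the outgoing solution u and of
   u' / (i omega), as exponential sums in omega and up to a common factor.  In a
   layer of speed c the combinations u + c u' / (i omega) and
   u - c u' / (i omega) are the right- and left-going waves. *)
Fixpoint state (M : medium) : list (R * R) * list (R * R) :=
  match M with
  | Half c => ([(1, 0)], [(/ c, 0)])
  | Layer c d M =>
      let (P, Q) := state M in
      let A := eshift (- (d / c)) (P ++ escale c Q) in
      let B := eshift (d / c) (P ++ escale (- c) Q) in
      (escale (/ 2) (A ++ B), escale (/ (2 * c)) (A ++ escale (- 1) B))
  end.

(* The exponential [e^(i omega t)] at the imaginary frequency [omega = i s]. *)
Definition lap (s t : R) : R := exp (- (s * t)).

Lemma lap_add (s t t' : R) : lap s (t + t') = lap s t * lap s t'.
Proof. unfold lap. rewrite <- exp_plus. f_equal; ring. Qed.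

Lemma lap_pos (s t : R) : 0 < lap s t.
Proof. apply exp_pos. Qed.

Lemma lap_opp (s t : R) : lap s t * lap s (- t) = 1.
Proof. rewrite <- lap_add. unfold lap. rewrite <- exp_0. f_equal; ring. Qed.

Definition lp (M : medium) (s : R) : R := ev (lap s) (fst (state M)).
Definition lq (M : medium) (s : R) : R := ev (lap s) (snd (state M)).

Lemma ev_lap_eshift (s y : R) (L : list (R * R)) :
  ev (lap s) (eshift y L) = lap s y * ev (lap s) L.
Proof.
  rewrite ev_eshift, <- ev_scal. apply ev_ext; intros; apply lap_add.
Qed.

Lemma lp_Half (c s : R) : lp (Half c) s = 1.
Proof. unfold lp, lap; simpl. rewrite Rmult_0_r, Ropp_0, exp_0; ring. Qed.

Lemma lq_Half (c s : R) : lq (Half c) s = / c.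
Proof. unfold lq, lap; simpl. rewrite Rmult_0_r, Ropp_0, exp_0; ring. Qed.

Lemma lp_Layer (c d : R) (M : medium) (s : R) :
  lp (Layer c d M) s = (lap s (- (d / c)) * (lp M s + c * lq M s)
                        + lap s (d / c) * (lp M s - c * lq M s)) / 2.
Proof.
  unfold lp, lq; simpl. destruct (state M) as [P Q]; simpl.
  rewrite ev_escale, ev_app, !ev_lap_eshift, !ev_app, !ev_escale. field.
Qed.

Lemma lq_Layer (c d : R) (M : medium) (s : R) :
  lq (Layer c d M) s = (lap s (- (d / c)) * (lp M s + c * lq M s)
                        - lap s (d / c) * (lp M s - c * lq M s)) * / (2 * c).
Proof.
  unfold lp, lq; simpl. destruct (state M) as [P Q]; simpl.
  rewrite ev_escale, ev_app, ev_escale, !ev_lap_eshift, !ev_app, !ev_escale. ring.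
Qed.

(** At imaginary frequency the right-going part [p + q] exceeds the left-going part [p - q] in
    absolute value, and crossing a layer leftwards gives it the larger exponential, so both sum and
    difference stay positive. *)
Lemma lp_lq_pos (M : medium) (s : R) : wf M -> 0 < s -> 0 < lp M s /\ 0 < lq M s.
Proof.
  intros HM Hs; induction M as [c|c d M IH].
  - rewrite lp_Half, lq_Half. simpl in HM. split; [lra|now apply Rinv_0_lt_compat].
  - destruct HM as (Hc & Hd & HM). destruct (IH HM) as [Hp Hq].
    rewrite lp_Layer, lq_Layer.
    assert (Hcq : 0 < c * lq M s) by now apply Rmult_lt_0_compat.
    assert (Ha : lap s (d / c) < lap s (- (d / c))).
    { apply exp_increasing. assert (0 < s * (d / c)); [|lra].
      apply Rmult_lt_0_compat; [easy|]. now apply Rdiv_lt_0_compat. }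
    pose proof (lap_pos s (d / c)) as Hb.
    set (al := lap s (- (d / c))) in *. set (be := lap s (d / c)) in *.
    set (p := lp M s) in *. set (q := c * lq M s) in *. split.
    + enough (0 < al * (p + q) + be * (p - q)) by lra. nra.
    + apply Rmult_lt_0_compat; [nra|apply Rinv_0_lt_compat; lra].
Qed.

(** Equality of the impedances P / Q at imaginary frequencies, cross-multiplied. *)
Definition same_response (M M' : medium) : Prop :=
  forall s, 0 < s -> lp M s * lq M' s = lq M s * lp M' s.

(** The two sides compare the left-going wave with the right-going one. Their ratio, a reflection
    coefficient, is damped by the round trip through the first layer, whence [D = 2 * (d / c)]; a
    half-line reflects nothing, and any [D] will do. *)
Lemma response_decay (M : medium) : wf M -> exists D, 0 < D /\
  forall s, 0 < s -> Rabs (lp M s - lead M * lq M s)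
                     <= (lp M s + lead M * lq M s) * exp (- (s * D)).
Proof.
  destruct M as [c|c d M]; simpl.
  - intros Hc. exists 1; split; [lra|]. intros s Hs.
    rewrite lp_Half, lq_Half, Rinv_r by lra.
    rewrite Rminus_diag, Rabs_R0. pose proof (exp_pos (- (s * 1))); lra.
  - intros (Hc & Hd & HM). exists (2 * (d / c)).
    assert (Hdc : 0 < d / c) by now apply Rdiv_lt_0_compat.
    split; [lra|]. intros s Hs.
    destruct (lp_lq_pos M s HM Hs) as [Hp Hq].
    assert (Hcq : 0 < c * lq M s) by now apply Rmult_lt_0_compat.
    replace (exp (- (s * (2 * (d / c))))) with (lap s (d / c) * lap s (d / c))
      by (rewrite <- lap_add; unfold lap; f_equal; ring).
    replace (lp (Layer c d M) s - c * lq (Layer c d M) s)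
      with (lap s (d / c) * (lp M s - c * lq M s))
      by (rewrite lp_Layer, lq_Layer; field; lra).
    replace (lp (Layer c d M) s + c * lq (Layer c d M) s)
      with (lap s (- (d / c)) * (lp M s + c * lq M s))
      by (rewrite lp_Layer, lq_Layer; field; lra).
    pose proof (lap_opp s (d / c)) as E. pose proof (lap_pos s (d / c)) as Hb.
    rewrite Rabs_mult, (Rabs_pos_eq (lap s (d / c))) by lra.
    replace (lap s (- (d / c)) * (lp M s + c * lq M s) * (lap s (d / c) * lap s (d / c)))
      with ((lap s (d / c) * lap s (- (d / c))) * (lap s (d / c) * (lp M s + c * lq M s)))
      by ring.
    rewrite E, Rmult_1_l. apply Rmult_le_compat_l; [lra|].
    apply Rabs_le; lra.
Qed.

Lemma exp_decay (D e : R) : 0 < D -> 0 < e ->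
  exists s0, 0 < s0 /\ forall s, s0 <= s -> exp (- (s * D)) <= e.
Proof.
  intros HD He. exists (Rmax 1 (- ln e / D)). split.
  - pose proof (Rmax_l 1 (- ln e / D)); lra.
  - intros s Hs. rewrite <- (exp_ln e He) at 1.
    assert (H : - ln e <= s * D).
    { pose proof (Rmax_r 1 (- ln e / D)).
      replace (- ln e) with ((- ln e / D) * D) by (field; lra).
      apply Rmult_le_compat_r; lra. }
    destruct (Rle_lt_or_eq_dec (- (s * D)) (ln e)) as [Hl|Hl]; [lra| |].
    + left; now apply exp_increasing.
    + rewrite Hl; right; reflexivity.
Qed.

(** By [response_decay] the common ratio P / Q tends to both leading speeds as [s] grows. *)
Lemma lead_response (M M' : medium) :
  wf M -> wf M' -> same_response M M' -> lead M = lead M'.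
Proof.
  intros HM HM' HS.
  assert (Hc : 0 < lead M) by (destruct M; simpl in *; tauto).
  assert (Hc' : 0 < lead M') by (destruct M'; simpl in *; tauto).
  destruct (response_decay M HM) as (D & HD & H).
  destruct (response_decay M' HM') as (D' & HD' & H').
  set (c := lead M) in *. set (c' := lead M') in *.
  assert (Hb : forall e, 0 < e <= / 3 -> Rabs (c - c') <= e * (5 * c + c')).
  { intros e He.
    destruct (exp_decay D e HD (proj1 He)) as (s1 & Hs1 & E1).
    destruct (exp_decay D' e HD' (proj1 He)) as (s2 & Hs2 & E2).
    set (s := Rmax s1 s2).
    assert (Hs : s1 <= s /\ s2 <= s) by (split; [apply Rmax_l|apply Rmax_r]).
    assert (Hs0 : 0 < s) by lra.
    specialize (E1 s (proj1 Hs)). specialize (E2 s (proj2 Hs)).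
    specialize (H s Hs0). specialize (H' s Hs0). specialize (HS s Hs0).
    destruct (lp_lq_pos M s HM Hs0) as [Hp Hq].
    destruct (lp_lq_pos M' s HM' Hs0) as [Hp' Hq'].
    set (p := lp M s) in *. set (q := lq M s) in *.
    set (p' := lp M' s) in *. set (q' := lq M' s) in *.
    set (x := p / q).
    assert (Ep : p = x * q) by (unfold x; field; lra).
    assert (Ep' : p' = x * q') by (unfold x; rewrite <- (Rmult_1_l p');
      replace (p / q * q') with (p * q' / q) by (field; lra); rewrite HS; field; lra).
    assert (Hx : 0 < x) by (unfold x; now apply Rdiv_lt_0_compat).
    rewrite Ep in H; rewrite Ep' in H'.
    replace (x * q - c * q) with ((x - c) * q) in H by ring.
    replace (x * q' - c' * q') with ((x - c') * q') in H' by ring.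
    rewrite Rabs_mult, (Rabs_pos_eq q) in H by lra.
    rewrite Rabs_mult, (Rabs_pos_eq q') in H' by lra.
    assert (B : Rabs (x - c) <= (x + c) * e).
    { apply (Rmult_le_reg_r q); [easy|]. apply (Rle_trans _ _ _ H).
      replace ((x * q + c * q) * exp (- (s * D))) with ((x + c) * q * exp (- (s * D))) by ring.
      replace ((x + c) * e * q) with ((x + c) * q * e) by ring.
      apply Rmult_le_compat_l; [|easy]. nra. }
    assert (B' : Rabs (x - c') <= (x + c') * e).
    { apply (Rmult_le_reg_r q'); [easy|]. apply (Rle_trans _ _ _ H').
      replace ((x * q' + c' * q') * exp (- (s * D'))) with ((x + c') * q' * exp (- (s * D'))) by ring.
      replace ((x + c') * e * q') with ((x + c') * q' * e) by ring.
      apply Rmult_le_compat_l; [|easy]. nra. }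
    apply Rabs_le_between in B. apply Rabs_le_between in B'.
    (* From [x - c <= (x + c) * e] and [e <= / 3]. The triangle inequality bounds the distance of
       the speeds by [e * (2 * x + c + c')], hence by [e * (5 * c + c')]. *)
    assert (x <= 2 * c) by nra.
    apply Rabs_le. nra. }
  destruct (Req_dec c c') as [E|E]; [easy|exfalso].
  assert (Hpos : 0 < Rabs (c - c')) by (apply Rabs_pos_lt; lra).
  (* Small enough for the bound in [Hb] to be at most half of the positive number it bounds. *)
  set (e := Rmin (/ 3) (Rabs (c - c') / (2 * (5 * c + c')))).
  assert (He : 0 < e <= / 3).
  { unfold e; split; [apply Rmin_pos; [lra|apply Rdiv_lt_0_compat; lra]|apply Rmin_l]. }
  specialize (Hb e He).
  assert (e * (5 * c + c') <= Rabs (c - c') / 2).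
  { replace (Rabs (c - c') / 2) with (Rabs (c - c') / (2 * (5 * c + c')) * (5 * c + c'))
      by (field; lra).
    apply Rmult_le_compat_r; [lra|apply Rmin_r]. }
  lra.
Qed.

(** A layer acts on the pair (P, Q) by a linear map of determinant [be * al = 1], which preserves
    the cross product [p * q' - q * p']. *)
Lemma same_response_peel (c d : R) (M M' : medium) : 0 < c ->
  same_response (Layer c d M) (Layer c d M') -> same_response M M'.
Proof.
  intros Hc H s Hs. specialize (H s Hs).
  rewrite !lp_Layer, !lq_Layer in H.
  pose proof (lap_opp s (d / c)) as E.
  set (be := lap s (d / c)) in *. set (al := lap s (- (d / c))) in *.
  set (p := lp M s) in *. set (q := lq M s) in *.
  set (p' := lp M' s) in *. set (q' := lq M' s) in *.
  assert (H2 : (be * al) * (p * q' - q * p') = 0).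
  { apply Rminus_diag_eq in H. rewrite <- H. field. lra. }
  rewrite E in H2. lra.
Qed.

Lemma same_response_sym (M M' : medium) : same_response M M' -> same_response M' M.
Proof. intros H s Hs. specialize (H s Hs). lra. Qed.

(** An interface without contrast is invisible: the exponentials of the two travel times multiply to
    that of their sum. *)
Lemma same_response_split (c d d' : R) (M M' : medium) : c <> 0 ->
  same_response M (Layer c (d + d') M') -> same_response M (Layer c d (Layer c d' M')).
Proof.
  intros Hc H s Hs. specialize (H s Hs).
  rewrite lp_Layer, lq_Layer in *. rewrite lp_Layer, lq_Layer.
  replace ((d + d') / c) with (d / c + d' / c) in H by (field; lra).
  rewrite Ropp_plus_distr, !lap_add in H.
  set (p := lp M' s) in *. set (q := lq M' s) in *.
  match goal with |- ?l = ?r => match type of H with ?l' = ?r' =>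
    replace l with l' by (field; lra); replace r with r' by (field; lra) end end.
  easy.
Qed.

(** A layer in front of a half-line of equal speed multiplies P and Q by the same exponential, which
    leaves the response unchanged. *)
Lemma same_response_split_Half (c d : R) (M : medium) : c <> 0 ->
  same_response M (Half c) -> same_response M (Layer c d (Half c)).
Proof.
  intros Hc H s Hs. specialize (H s Hs).
  rewrite lp_Half, lq_Half in H. rewrite lp_Layer, lq_Layer, lp_Half, lq_Half.
  rewrite Rinv_r by easy.
  replace (lp M s * ((lap s (- (d / c)) * (1 + 1) - lap s (d / c) * (1 - 1)) * / (2 * c)))
    with (lap s (- (d / c)) * (lp M s * / c)) by (field; easy).
  rewrite H. field.
Qed.

Lemma mspeed_split (c d d' : R) (M : medium) (y x : R) : 0 < d' ->
  mspeed y (Layer c d (Layer c d' M)) x = mspeed y (Layer c (d + d') M) x.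
Proof.
  intros Hd'; simpl. rewrite Rplus_assoc.
  destruct (Rle_dec x (y + d)); destruct (Rle_dec x (y + (d + d'))); easy || lra.
Qed.

Lemma mspeed_split_Half (c d y x : R) : mspeed y (Layer c d (Half c)) x = c.
Proof. simpl; now destruct (Rle_dec x (y + d)). Qed.

(* Induction on the total number of layers: if the first layers have different
   thickness, the thicker one is split at the interface of the other. *)
Lemma response_inj (M M' : medium) (y x : R) : wf M -> wf M' ->
  same_response M M' -> mspeed y M x = mspeed y M' x.
Proof.
  remember (layers M + layers M')%nat as n eqn:En.
  assert (Hn : (layers M + layers M' <= n)%nat) by lia. clear En.
  revert M M' y Hn; induction n as [|n IH]; intros M M' y Hn HM HM' HS;
    pose proof (lead_response M M' HM HM' HS) as HL;
    destruct M as [c|c d M], M' as [c'|c' d' M']; simpl in Hn, HL; try lia; subst c'; try easy.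
  - destruct HM' as (Hc & Hd & HM').
    (* The half-line is cut at the interface of the other medium. Removing the common layer leaves
       the half-line as it was and [M'] with one layer fewer. *)
    rewrite <- (mspeed_split_Half c d' y x) at 1. simpl.
    destruct (Rle_dec x (y + d')); [easy|].
    apply (IH (Half c) M'); simpl; [lia|easy|easy|].
    apply (same_response_peel c d'); [easy|].
    apply same_response_sym, same_response_split_Half; [lra|].
    now apply same_response_sym.
  - destruct HM as (Hc & Hd & HM).
    rewrite <- (mspeed_split_Half c d y x). simpl.
    destruct (Rle_dec x (y + d)); [easy|].
    apply (IH M (Half c)); simpl; [lia|easy|easy|].
    apply (same_response_peel c d); [easy|].
    apply same_response_split_Half; [lra|easy].
  - destruct HM as (Hc & Hd & HM). destruct HM' as (_ & Hd' & HM').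
    destruct (Rtotal_order d d') as [Hlt|[->|Hlt]].
    (* The remainder of the thicker layer is still a layer, so only the count of the other medium
       drops, which suffices for the induction. *)
    + replace d' with (d + (d' - d)) in HS |- * by ring.
      rewrite <- mspeed_split by lra. simpl.
      destruct (Rle_dec x (y + d)); [easy|].
      apply (IH M (Layer c (d' - d) M')); simpl; [lia|easy|repeat split; easy || lra|].
      apply (same_response_peel c d); [easy|].
      apply same_response_split; [lra|easy].
    + simpl. destruct (Rle_dec x (y + d')); [easy|].
      apply IH; [lia|easy|easy|]. now apply (same_response_peel c d').
    + replace d with (d' + (d - d')) in HS |- * by ring.
      rewrite <- mspeed_split by lra. simpl.
      destruct (Rle_dec x (y + d')); [easy|].
      apply (IH (Layer c (d - d') M) M'); simpl; [lia|repeat split; easy || lra|easy|].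
      apply (same_response_peel c d'); [easy|].
      apply same_response_sym, same_response_split; [lra|].
      now apply same_response_sym.
Qed.

(** * Smooth cutoffs *)

(** Bounding the order allows induction for families of functions closed under differentiation: to
    gain one order, it suffices that the derivative has the previous one. *)
Definition diff_upto (k : nat) (f : R -> R) : Prop :=
  forall j x, (j <= k)%nat -> ex_derive_n f j x.

Lemma diff_upto_smooth (f : R -> R) : (forall k, diff_upto k f) -> smooth f.
Proof. intros H k x; now apply (H k). Qed.

Lemma smooth_diff_upto (f : R -> R) (k : nat) : smooth f -> diff_upto k f.
Proof. intros H j x _; apply H. Qed.

Lemma diff_upto_0 (f : R -> R) : diff_upto 0 f.
Proof. intros j x Hj. replace j with 0%nat by lia. exact I. Qed.

Lemma diff_upto_S (k : nat) (f g : R -> R) :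
  (forall x, is_derive f x (g x)) -> diff_upto k g -> diff_upto (S k) f.
Proof.
  intros Hf Hg [|[|j]] x Hj; [exact I| |].
  - now exists (g x).
  - assert (Hj' : (S j <= k)%nat) by lia. specialize (Hg (S j) x Hj').
    simpl in Hg |- *. apply (ex_derive_ext (Derive_n g j)); [|easy].
    intros t. change (Derive (Derive_n f j) t) with (Derive_n f (S j) t).
    replace (S j) with (j + 1)%nat by lia. rewrite <- Derive_n_comp.
    apply Derive_n_ext. intros; symmetry; now apply is_derive_unique.
Qed.

Lemma diff_upto_plus (k : nat) (f g : R -> R) :
  diff_upto k f -> diff_upto k g -> diff_upto k (fun x => f x + g x).
Proof.
  intros Hf Hg j x Hj.
  apply ex_derive_n_plus; apply filter_forall; intros; [apply Hf|apply Hg]; lia.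
Qed.

Lemma diff_upto_scal (k : nat) (a : R) (f : R -> R) :
  diff_upto k f -> diff_upto k (fun x => a * f x).
Proof. intros Hf j x Hj. apply ex_derive_n_scal_l; now apply Hf. Qed.

Lemma smooth_is_derive (f : R -> R) (x : R) : smooth f -> is_derive f x (Derive f x).
Proof. intros Hf. apply Derive_correct. exact (Hf 1%nat x). Qed.

Lemma smooth_Derive (f : R -> R) : smooth f -> smooth (Derive f).
Proof.
  intros Hf [|k] x; [exact I|]. specialize (Hf (S (S k)) x). simpl in *.
  apply (ex_derive_ext (Derive_n f (S k))); [|easy].
  intros t. replace (S k) with (k + 1)%nat by lia. now rewrite <- Derive_n_comp.
Qed.

Lemma smooth_of_derive (f g : R -> R) :
  (forall x, is_derive f x (g x)) -> smooth g -> smooth f.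
Proof.
  intros Hf Hg k x.
  apply (diff_upto_S k f g Hf (smooth_diff_upto _ _ Hg)); lia.
Qed.

Lemma smooth_continuous (f : R -> R) (x : R) : smooth f -> continuous f x.
Proof. intros Hf. apply (ex_derive_continuous f). exact (Hf 1%nat x). Qed.

Lemma smooth_plus (f g : R -> R) : smooth f -> smooth g -> smooth (fun x => f x + g x).
Proof.
  intros Hf Hg; apply diff_upto_smooth; intros k.
  apply diff_upto_plus; now apply smooth_diff_upto.
Qed.

Lemma smooth_scal (a : R) (f : R -> R) : smooth f -> smooth (fun x => a * f x).
Proof.
  intros Hf; apply diff_upto_smooth; intros k.
  apply diff_upto_scal; now apply smooth_diff_upto.
Qed.

Lemma smooth_mult (f g : R -> R) : smooth f -> smooth g -> smooth (fun x => f x * g x).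
Proof.
  intros Hf Hg; apply diff_upto_smooth; intros k; revert f g Hf Hg.
  induction k as [|k IH]; intros f g Hf Hg; [apply diff_upto_0|].
  apply (diff_upto_S k _ (fun x => Derive f x * g x + f x * Derive g x)).
  - intros x. apply Derive.is_derive_mult; now apply smooth_is_derive.
  - apply diff_upto_plus; apply IH; try easy; now apply smooth_Derive.
Qed.

Lemma smooth_affine (f : R -> R) (a b : R) : smooth f -> smooth (fun x => f (a * x + b)).
Proof.
  intros Hf; apply diff_upto_smooth; intros k; revert f Hf.
  induction k as [|k IH]; intros f Hf; [apply diff_upto_0|].
  apply (diff_upto_S k _ (fun x => a * Derive f (a * x + b))).
  - intros x. apply (is_derive_comp f (fun x => a * x + b)).
    + now apply smooth_is_derive.
    + auto_derive; [easy|ring].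
  - apply diff_upto_scal, IH. now apply smooth_Derive.
Qed.

(** Each of [v] and [dv] has a multiple of the other as its derivative, so both gain orders
    together. *)
Lemma smooth_oscillation (k : R) (v dv : R -> R) :
  (forall x, is_derive v x (dv x)) -> (forall x, is_derive dv x (- k ^ 2 * v x)) -> smooth v.
Proof.
  intros Hv Hdv; apply diff_upto_smooth; intros n.
  enough (diff_upto n v /\ diff_upto n dv) by easy.
  induction n as [|n [IH1 IH2]]; [split; apply diff_upto_0|]. split.
  - now apply (diff_upto_S n _ dv).
  - apply (diff_upto_S n _ _ Hdv). now apply diff_upto_scal.
Qed.

(** The classical smooth function with all derivatives zero at the origin, with powers of [/ x]
    included so that derivatives are combinations of members of the family. *)
Definition flat (m : nat) (x : R) : R :=
  if Rlt_dec 0 x then (/ x) ^ m * exp (- / x) else 0.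

Lemma flat_pos (m : nat) (x : R) : 0 < x -> 0 < flat m x.
Proof.
  intros Hx; unfold flat; destruct (Rlt_dec 0 x); [|easy].
  apply Rmult_lt_0_compat; [|apply exp_pos].
  now apply pow_lt, Rinv_0_lt_compat.
Qed.

Lemma flat_nonpos (m : nat) (x : R) : x <= 0 -> flat m x = 0.
Proof. intros Hx; unfold flat; destruct (Rlt_dec 0 x); lra. Qed.

(** Write [exp y] as the power [S n] of [exp (y / INR (S n))], which is at least [y / INR (S n)]. *)
Lemma pow_exp_bound (n : nat) (y : R) : 0 <= y ->
  y ^ S n * exp (- y) <= INR (S n) ^ S n.
Proof.
  intros Hy. pose proof (lt_0_INR (S n) ltac:(lia)) as Hn.
  assert (E : exp y = exp (y / INR (S n)) ^ S n).
  { rewrite <- Rpower_pow by apply exp_pos. unfold Rpower.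
    rewrite ln_exp. f_equal. field; lra. }
  assert (B : (y / INR (S n)) ^ S n <= exp y).
  { rewrite E. apply pow_incr. split; [apply Rdiv_le_0_compat; lra|].
    pose proof (exp_ineq1_le (y / INR (S n))); lra. }
  replace (y ^ S n) with (INR (S n) ^ S n * (y / INR (S n)) ^ S n)
    by (rewrite <- Rpow_mult_distr; f_equal; field; lra).
  rewrite Rmult_assoc. rewrite <- (Rmult_1_r (INR (S n) ^ S n)) at 2.
  apply Rmult_le_compat_l; [apply pow_le; lra|].
  apply (Rmult_le_reg_r (exp y)); [apply exp_pos|].
  rewrite Rmult_assoc, <- exp_plus. replace (- y + y) with 0 by ring.
  rewrite exp_0. lra.
Qed.

(** For use at the origin, where it makes the derivative zero. Two powers of [/ x] are traded for
    the factor [x ^ 2], and the rest is bounded by [pow_exp_bound]. *)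
Lemma flat_quadratic (m : nat) : exists K, 0 < K /\ forall x, Rabs (flat m x) <= K * x ^ 2.
Proof.
  exists (INR (S (S m)) ^ S (S m)). split; [apply pow_lt, lt_0_INR; lia|].
  intros x. assert (Hn : 0 <= INR (S (S m)) ^ S (S m)) by apply pow_le, pos_INR.
  destruct (Rlt_dec 0 x) as [Hx|Hx].
  - rewrite Rabs_pos_eq by (left; now apply flat_pos).
    unfold flat; destruct (Rlt_dec 0 x); [|easy].
    assert (Hy : 0 <= / x) by (left; now apply Rinv_0_lt_compat).
    pose proof (pow_exp_bound (S m) (/ x) Hy) as B.
    replace ((/ x) ^ m * exp (- / x)) with ((/ x) ^ S (S m) * exp (- / x) * x ^ 2)
      by (simpl; field; lra).
    apply Rmult_le_compat_r; [apply pow2_ge_0|easy].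
  - rewrite flat_nonpos, Rabs_R0 by lra. apply Rmult_le_pos; [easy|apply pow2_ge_0].
Qed.

Lemma is_derive_quadratic (f : R -> R) (K : R) :
  0 < K -> (forall x, Rabs (f x) <= K * x ^ 2) -> is_derive f 0 0.
Proof.
  intros HK Hf. apply is_derive_Reals. intros e He.
  assert (Hd : 0 < e / K) by now apply Rdiv_lt_0_compat.
  exists (mkposreal _ Hd). intros h Hh Hlt; simpl in Hlt.
  assert (E : f 0 = 0).
  { specialize (Hf 0). replace (K * 0 ^ 2) with 0 in Hf by ring.
    pose proof (Rabs_pos (f 0)). apply Rabs_eq_0; lra. }
  rewrite E, Rplus_0_l, !Rminus_0_r. unfold Rdiv; rewrite Rabs_mult, Rabs_inv.
  assert (Hp : 0 < Rabs h) by now apply Rabs_pos_lt.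
  apply (Rmult_lt_reg_r (Rabs h)); [easy|].
  rewrite Rmult_assoc, Rinv_l, Rmult_1_r by lra.
  apply (Rle_lt_trans _ _ _ (Hf h)).
  rewrite <- pow2_abs.
  assert (K * Rabs h < e).
  { replace e with (K * (e / K)) by (field; lra). now apply Rmult_lt_compat_l. }
  simpl. nra.
Qed.

Lemma is_derive_flat (m : nat) (x : R) :
  is_derive (flat m) x (flat (S (S m)) x + - INR m * flat (S m) x).
Proof.
  destruct (Rtotal_order x 0) as [Hx|[->|Hx]].
  - rewrite !flat_nonpos by lra. replace (0 + - INR m * 0) with 0 by ring.
    apply (is_derive_ext_loc (fun _ => 0)); [|apply @is_derive_const].
    apply (filter_imp (fun t => t < 0)); [|now apply open_lt].
    intros t Ht; symmetry; apply flat_nonpos; lra.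
  - rewrite !flat_nonpos by lra. replace (0 + - INR m * 0) with 0 by ring.
    destruct (flat_quadratic m) as (K & HK & B). now apply (is_derive_quadratic _ K).
  - apply (is_derive_ext_loc (fun t => (/ t) ^ m * exp (- / t))).
    + apply (filter_imp (fun t => 0 < t)); [|now apply open_gt].
      intros t Ht. unfold flat; now destruct (Rlt_dec 0 t).
    + unfold flat; destruct (Rlt_dec 0 x); [|easy].
      auto_derive; [lra|]. destruct m; simpl; field; lra.
Qed.

Lemma smooth_flat (m : nat) : smooth (flat m).
Proof.
  apply diff_upto_smooth; intros k; revert m.
  induction k as [|k IH]; intros m; [apply diff_upto_0|].
  apply (diff_upto_S k _ _ (is_derive_flat m)).
  apply diff_upto_plus; [apply IH|apply diff_upto_scal, IH].
Qed.

Lemma exists_ramp (a b : R) : a < b -> exists r : R -> R,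
  smooth r /\ (forall x, 0 <= Derive r x)
  /\ (forall x, x <= a \/ b <= x -> Derive r x = 0)
  /\ (forall x, x <= a -> r x = 0) /\ (forall x, b <= x -> r x = 1).
Proof.
  intros Hab.
  (* A smooth bump, positive exactly between [a] and [b]; the ramp is its primitive divided by its
     total integral. *)
  set (g := fun x => flat 0 (1 * x + - a) * flat 0 (-1 * x + b)).
  assert (Sg : smooth g) by (apply smooth_mult; apply smooth_affine, smooth_flat).
  assert (Gint : forall y z, ex_RInt g y z).
  { intros y z. apply (ex_RInt_continuous (V := R_CompleteNormedModule)). intros; now apply smooth_continuous. }
  assert (Gz : forall x, x <= a \/ b <= x -> g x = 0).
  { intros x [Hx|Hx]; unfold g; [rewrite (flat_nonpos 0 (1 * x + - a))|
      rewrite (flat_nonpos 0 (-1 * x + b))]; lra. }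
  assert (Gp : forall x, a < x < b -> 0 < g x).
  { intros x Hx; apply Rmult_lt_0_compat; apply flat_pos; lra. }
  assert (Ipos : 0 < RInt g a b).
  { apply RInt_gt_0; [easy|easy|intros; now apply smooth_continuous]. }
  set (I := RInt g a b) in *.
  assert (Dr : forall x, is_derive (fun x => / I * RInt g a x) x (/ I * g x)).
  { intros x. apply is_derive_scal.
    apply (is_derive_RInt g (RInt g a) a x).
    - apply filter_forall. intros; now apply (RInt_correct g).
    - now apply smooth_continuous. }
  assert (Zint : forall y z, y <= z -> (forall x, y < x < z -> g x = 0) -> RInt g y z = 0).
  { intros y z Hyz H. rewrite (RInt_ext g (fun _ => 0)).
    - rewrite RInt_const. unfold scal; simpl; unfold mult; simpl; ring.
    - rewrite Rmin_left, Rmax_right by easy. exact H. }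
  exists (fun x => / I * RInt g a x). repeat split.
  - apply (smooth_of_derive _ (fun x => / I * g x) Dr). now apply smooth_scal.
  - intros x. apply (Rle_trans _ (/ I * g x)); [|right; symmetry; apply is_derive_unique, Dr].
    apply Rmult_le_pos; [left; now apply Rinv_0_lt_compat|].
    destruct (Rle_dec x a); [rewrite Gz; lra|].
    destruct (Rle_dec b x); [rewrite Gz; lra|]. left; apply Gp; lra.
  - intros x Hx. transitivity (/ I * g x); [apply is_derive_unique, Dr|].
    rewrite Gz by easy; ring.
  - intros x Hx. rewrite <- opp_RInt_swap by easy.
    rewrite Zint; [unfold opp; simpl; ring|easy|intros; apply Gz; lra].
  - intros x Hx. rewrite <- (RInt_Chasles g a b x) by easy.
    rewrite (Zint b x); [|easy|intros; apply Gz; lra].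
    unfold plus; simpl. fold I. field; lra.
Qed.

(** * The Wronskian across a homogeneous region *)

Lemma ex_RInt_cont (f : R -> R) (a b : R) : a <= b ->
  (forall x, a <= x <= b -> continuous f x) -> ex_RInt f a b.
Proof.
  intros Hab H. apply (ex_RInt_continuous (V := R_CompleteNormedModule)).
  now rewrite Rmin_left, Rmax_right.
Qed.

Lemma is_RInt_derivative (f df : R -> R) (a b : R) : a <= b ->
  (forall x, a <= x <= b -> is_derive f x (df x)) ->
  (forall x, a <= x <= b -> continuous df x) -> is_RInt df a b (f b - f a).
Proof.
  intros Hab Hf Hc.
  apply (is_RInt_derive (V := R_CompleteNormedModule) f df); now rewrite Rmin_left, Rmax_right.
Qed.

Lemma is_RInt_ext_open (f g : R -> R) (a b l : R) : a <= b ->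
  (forall x, a < x < b -> f x = g x) -> is_RInt f a b l -> is_RInt g a b l.
Proof.
  intros Hab H. apply is_RInt_ext. now rewrite Rmin_left, Rmax_right.
Qed.

Lemma Derive_locally_const (f : R -> R) (x c : R) :
  locally x (fun t => f t = c) -> Derive f x = 0.
Proof.
  intros H. apply is_derive_unique. apply (is_derive_ext_loc (fun _ => c)).
  - apply (filter_imp (fun t => f t = c)); [now intros|easy].
  - apply @is_derive_const.
Qed.

(** The slope of the ramp is a probability density on the interval, and an average of values within
    [e] of [z] is within [e] of [z]. *)
Lemma ramp_average (r W : R -> R) (a b e z : R) : a < b -> smooth r ->
  (forall x, 0 <= Derive r x) -> r a = 0 -> r b = 1 ->
  (forall x, a <= x <= b -> continuous W x) ->
  (forall x, a <= x <= b -> Rabs (W x - z) <= e) ->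
  Rabs (RInt (fun x => Derive r x * W x) a b - z) <= e.
Proof.
  intros Hab Sr Hr Ha Hb CW BW.
  assert (Sd : smooth (Derive r)) by now apply smooth_Derive.
  assert (I1 : is_RInt (Derive r) a b 1).
  { replace 1 with (r b - r a) by lra. apply is_RInt_derivative; [lra| |].
    - intros; now apply smooth_is_derive.
    - intros; now apply smooth_continuous. }
  assert (I2 : is_RInt (fun x => Derive r x * W x) a b (RInt (fun x => Derive r x * W x) a b)).
  { apply (RInt_correct (V := R_CompleteNormedModule)), ex_RInt_cont; [lra|].
    intros x Hx. apply (continuous_mult (Derive r)); [now apply smooth_continuous|now apply CW]. }
  set (J := RInt (fun x => Derive r x * W x) a b) in *.
  assert (I3 : is_RInt (fun x => Derive r x * (W x - z)) a b (J - z)).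
  { apply (is_RInt_ext (fun x => minus (Derive r x * W x) (scal z (Derive r x)))).
    - intros x _. unfold minus, plus, opp, scal; simpl; unfold mult; simpl; ring.
    - replace (J - z) with (minus J (scal z 1))
        by (unfold minus, plus, opp, scal; simpl; unfold mult; simpl; ring).
      apply (is_RInt_minus (V := R_NormedModule)); [easy|]. now apply (is_RInt_scal (V := R_NormedModule)). }
  replace e with (scal e 1) by (unfold scal; simpl; unfold mult; simpl; ring).
  apply (norm_RInt_le (fun x => Derive r x * (W x - z)) (fun x => scal e (Derive r x)) a b);
    [lra| |easy|now apply (is_RInt_scal (V := R_NormedModule))].
  intros x Hx. unfold norm, scal; simpl. unfold abs, mult; simpl.
  rewrite Rabs_mult, (Rabs_pos_eq (Derive r x)) by apply Hr. rewrite Rmult_comm.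
  apply Rmult_le_compat_r; [apply Hr|now apply BW].
Qed.

Section Wronskian.

Variables (x0 k s : R) (w dw v dv : R -> R).
Hypothesis w_cont : forall x, continuous w x.
Hypothesis w_derive : forall x, x <> x0 -> is_derive w x (dw x).
Hypothesis dw_cont : forall x, x <> x0 -> continuous dw x.
Hypothesis v_derive : forall x, is_derive v x (dv x).
Hypothesis dv_derive : forall x, is_derive dv x (- k ^ 2 * v x).

Let W (x : R) : R := w x * dv x - dw x * v x.

Lemma v_cont (x : R) : continuous v x.
Proof. apply (ex_derive_continuous v). now exists (dv x). Qed.

Lemma dv_cont (x : R) : continuous dv x.
Proof. apply (ex_derive_continuous dv). now exists (- k ^ 2 * v x). Qed.

Lemma wronskian_cont (x : R) : x <> x0 -> continuous W x.
Proof.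
  intros Hx. apply (continuous_minus (fun x => w x * dv x) (fun x => dw x * v x)).
  - apply (continuous_mult w dv); [apply w_cont|apply dv_cont].
  - apply (continuous_mult dw v); [now apply dw_cont|apply v_cont].
Qed.

(* One integration by parts: [(w v r')' = w (2 v' r' + v r'') - r' W]. *)
Lemma ramp_parts (r : R -> R) (a b : R) : a <= b -> smooth r ->
  Derive r a = 0 -> Derive r b = 0 -> (x0 < a \/ b < x0) ->
  is_RInt (fun x => w x * (2 * dv x * Derive r x + v x * Derive (Derive r) x)) a b
    (RInt (fun x => Derive r x * W x) a b).
Proof.
  intros Hab Sr Ra Rb H0.
  pose proof (smooth_Derive _ Sr) as Sr1. pose proof (smooth_Derive _ Sr1) as Sr2.
  assert (I1 : is_RInt (fun x => Derive r x * W x) a b (RInt (fun x => Derive r x * W x) a b)).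
  { apply (RInt_correct (V := R_CompleteNormedModule)), ex_RInt_cont; [easy|].
    intros x Hx. apply (continuous_mult (Derive r)); [now apply smooth_continuous|].
    apply wronskian_cont; lra. }
  assert (I2 : is_RInt (fun x => (dw x * v x + w x * dv x) * Derive r x
                                 + (w x * v x) * Derive (Derive r) x) a b 0).
  { replace 0 with (w b * v b * Derive r b - w a * v a * Derive r a)
      by (rewrite Ra, Rb; ring).
    apply (is_RInt_derivative (fun x => w x * v x * Derive r x)); [easy| |].
    - intros x Hx.
      apply (Derive.is_derive_mult (fun x => w x * v x) (Derive r)).
      + apply Derive.is_derive_mult; [apply w_derive; lra|apply v_derive].
      + now apply smooth_is_derive.
    - intros x Hx.
      apply (continuous_plus (fun x => (dw x * v x + w x * dv x) * Derive r x)
                             (fun x => (w x * v x) * Derive (Derive r) x)).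
      + apply (continuous_mult (fun x => dw x * v x + w x * dv x));
          [|now apply smooth_continuous].
        apply (continuous_plus (fun x => dw x * v x) (fun x => w x * dv x)).
        * apply (continuous_mult dw v); [apply dw_cont; lra|apply v_cont].
        * apply (continuous_mult w dv); [apply w_cont|apply dv_cont].
      + apply (continuous_mult (fun x => w x * v x)); [|now apply smooth_continuous].
        apply (continuous_mult w v); [apply w_cont|apply v_cont]. }
  rewrite <- (Rplus_0_l (RInt _ a b)).
  apply (is_RInt_ext_open (fun x => plus ((dw x * v x + w x * dv x) * Derive r x
          + (w x * v x) * Derive (Derive r) x) (Derive r x * W x))); [easy| |].
  - intros x _. unfold W, plus; simpl. ring.
  - now apply (is_RInt_plus (V := R_NormedModule)).
Qed.


Lemma wronskian_near (y e : R) : y <> x0 -> 0 < e -> exists d, 0 < d /\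
  forall x, Rabs (x - y) < d -> x <> x0 /\ Rabs (W x - W y) <= e.
Proof.
  intros Hy He.
  pose proof (proj1 (filterlim_locally W (W y)) (wronskian_cont y Hy) (mkposreal e He)) as [d Hd].
  assert (H0 : 0 < Rabs (x0 - y)) by (apply Rabs_pos_lt; lra).
  exists (Rmin d (Rabs (x0 - y))). split; [apply Rmin_pos; [apply cond_pos|easy]|].
  intros x Hx. pose proof (Rmin_l d (Rabs (x0 - y))). pose proof (Rmin_r d (Rabs (x0 - y))).
  split; [intros ->; lra|].
  left. apply Hd. unfold ball; simpl. unfold AbsRing_ball, abs, minus, plus, opp; simpl.
  fold (x - y). lra.
Qed.

(* The source strength s is 1 for the real part of an outgoing solution and 0
   for its imaginary part.  The test function is v times a cutoff that ramps up
   next to y1 and down next to y2; as the ramps get steeper, the averages of W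
   against their slopes tend to [W y1] and [W y2]. *)
Lemma wronskian_jump (y1 y2 : R) : y1 < y2 -> y1 <> x0 -> y2 <> x0 ->
  (forall phi, smooth phi -> (forall x, ~ (y1 <= x <= y2) -> phi x = 0) ->
    is_RInt (fun x => w x * Derive_n phi 2 x + k ^ 2 * w x * phi x) y1 y2 (- (s * phi x0))) ->
  W y2 - W y1 = s * (chi_Ioc y1 y2 x0 * v x0).
Proof.
  intros H12 H1 H2 weak.
  assert (Sv : smooth v) by now apply (smooth_oscillation k v dv).
  enough (B : forall e, 0 < e -> Rabs (W y2 - W y1 - s * (chi_Ioc y1 y2 x0 * v x0)) <= 2 * e).
  { apply Rminus_diag_uniq, Rabs_eq_0, Rle_antisym; [|apply Rabs_pos].
    apply le_epsilon. intros e He. specialize (B (e / 2) ltac:(lra)). lra. }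
  intros e He.
  destruct (wronskian_near y1 e H1 He) as (d1 & Hd1 & N1).
  destruct (wronskian_near y2 e H2 He) as (d2 & Hd2 & N2).
  (* The halving keeps each ramp strictly inside its neighbourhood and makes the ramp up end before
     the ramp down starts. *)
  set (d := Rmin (Rmin d1 d2) (y2 - y1) / 2).
  assert (Hd : 0 < d /\ d < d1 /\ d < d2 /\ y1 + d <= y2 - d).
  { unfold d. pose proof (Rmin_l (Rmin d1 d2) (y2 - y1)).
    pose proof (Rmin_r (Rmin d1 d2) (y2 - y1)).
    pose proof (Rmin_l d1 d2). pose proof (Rmin_r d1 d2).
    assert (0 < Rmin (Rmin d1 d2) (y2 - y1)) by (repeat apply Rmin_pos; lra). lra. }
  clearbody d. destruct Hd as (Hd & Hdd1 & Hdd2 & Hm).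
  assert (N1' : forall x, y1 <= x <= y1 + d -> x <> x0 /\ Rabs (W x - W y1) <= e).
  { intros x Hx; apply N1. rewrite Rabs_pos_eq; lra. }
  assert (N2' : forall x, y2 - d <= x <= y2 -> x <> x0 /\ Rabs (W x - W y2) <= e).
  { intros x Hx; apply N2. rewrite Rabs_left1; lra. }
  destruct (exists_ramp y1 (y1 + d)) as (r1 & S1 & P1 & D1 & L1 & U1); [lra|].
  destruct (exists_ramp (y2 - d) y2) as (r2 & S2 & P2 & D2 & L2 & U2); [lra|].
  assert (F1 : x0 < y1 \/ y1 + d < x0).
  { destruct (Rlt_dec x0 y1); [now left|]. destruct (Rlt_dec (y1 + d) x0); [now right|].
    exfalso; apply (proj1 (N1' x0 ltac:(lra))); easy. }
  assert (F2 : x0 < y2 - d \/ y2 < x0).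
  { destruct (Rlt_dec x0 (y2 - d)); [now left|]. destruct (Rlt_dec y2 x0); [now right|].
    exfalso; apply (proj1 (N2' x0 ltac:(lra))); easy. }
  pose proof (smooth_Derive _ S1) as S1'. pose proof (smooth_Derive _ S1') as S1''.
  pose proof (smooth_Derive _ S2) as S2'. pose proof (smooth_Derive _ S2') as S2''.
  set (phi := fun x => (r1 x + -1 * r2 x) * v x).
  assert (Sphi : smooth phi).
  { apply smooth_mult; [|easy]. apply smooth_plus; [easy|now apply smooth_scal]. }
  (* Since v'' = - k^2 v, the terms without a derivative of the cutoff combine into [- k ^ 2 * phi],
     which cancels the zeroth-order term of the weak equation. *)
  assert (Dphi : forall x, Derive_n phi 2 x =
    (Derive (Derive r1) x - Derive (Derive r2) x) * v x
    + 2 * (Derive r1 x - Derive r2 x) * dv x - k ^ 2 * phi x).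
  { intros x. simpl.
    transitivity (Derive (fun x => (Derive r1 x - Derive r2 x) * v x
                                   + (r1 x + - 1 * r2 x) * dv x) x).
    - apply Derive_ext. intros t. apply is_derive_unique.
      apply (Derive.is_derive_mult (fun x => r1 x + -1 * r2 x)); [|apply v_derive].
      replace (Derive r1 t - Derive r2 t) with (plus (Derive r1 t) (-1 * Derive r2 t))
        by (unfold plus; simpl; ring).
      apply (is_derive_plus (V := R_NormedModule) r1 (fun x => -1 * r2 x)); [now apply smooth_is_derive|].
      apply (is_derive_scal r2); now apply smooth_is_derive.
    - apply is_derive_unique.
      replace (_ + _ - _) with (plus
        ((Derive (Derive r1) x - Derive (Derive r2) x) * v x + (Derive r1 x - Derive r2 x) * dv x)
        ((Derive r1 x + - 1 * Derive r2 x) * dv x + (r1 x + -1 * r2 x) * (- k ^ 2 * v x)))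
        by (unfold plus, phi; simpl; ring).
      apply (is_derive_plus (V := R_NormedModule)
               (fun x => (Derive r1 x - Derive r2 x) * v x) (fun x => (r1 x + -1 * r2 x) * dv x)).
      + apply (Derive.is_derive_mult (fun x => Derive r1 x - Derive r2 x)); [|easy].
        apply (is_derive_minus (Derive r1) (Derive r2)); now apply smooth_is_derive.
      + apply (Derive.is_derive_mult (fun x => r1 x + -1 * r2 x)); [|easy].
        apply (is_derive_plus (V := R_NormedModule) r1 (fun x => -1 * r2 x));
          [now apply smooth_is_derive|].
        apply (is_derive_scal r2); now apply smooth_is_derive. }
  set (F := fun (r : R -> R) x => w x * (2 * dv x * Derive r x + v x * Derive (Derive r) x)).
  pose proof (ramp_parts r1 y1 (y1 + d) ltac:(lra) S1
    (D1 y1 ltac:(lra)) (D1 (y1 + d) ltac:(lra)) F1) as R1.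
  pose proof (ramp_parts r2 (y2 - d) y2 ltac:(lra) S2
    (D2 (y2 - d) ltac:(lra)) (D2 y2 ltac:(lra)) F2) as R2.
  fold (F r1) in R1. fold (F r2) in R2.
  assert (Z1 : forall x, y1 + d < x -> F r1 x = 0).
  { intros x Hx. unfold F. rewrite (D1 x) by lra.
    rewrite (Derive_locally_const (Derive r1) x 0); [ring|].
    apply (filter_imp (fun t => y1 + d < t)); [intros; apply D1; lra|now apply open_gt]. }
  assert (Z2 : forall x, x < y2 - d -> F r2 x = 0).
  { intros x Hx. unfold F. rewrite (D2 x) by lra.
    rewrite (Derive_locally_const (Derive r2) x 0); [ring|].
    apply (filter_imp (fun t => t < y2 - d)); [intros; apply D2; lra|now apply open_lt]. }
  assert (Zint : forall f a b, a <= b -> (forall x, a < x < b -> f x = 0) -> is_RInt f a b 0).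
  { intros f a b Hab Hf. apply (is_RInt_ext_open (fun _ => 0)); [easy|intros; now rewrite Hf|].
    assert (H : is_RInt (fun _ => 0) a b (0 - 0)).
    { apply (is_RInt_derivative (fun _ => 0)); [easy| |].
      - intros; apply @is_derive_const.
      - intros; apply @continuous_const. }
    now rewrite Rminus_diag in H. }
  set (A1 := RInt (fun x => Derive r1 x * W x) y1 (y1 + d)) in *.
  set (A2 := RInt (fun x => Derive r2 x * W x) (y2 - d) y2) in *.
  assert (T1 : is_RInt (F r1) y1 y2 (plus A1 0)).
  { apply (is_RInt_Chasles (V := R_NormedModule)) with (y1 + d); [easy|].
    apply Zint; [lra|]. intros; apply Z1; lra. }
  assert (T2 : is_RInt (F r2) y1 y2 (plus 0 A2)).
  { apply (is_RInt_Chasles (V := R_NormedModule)) with (y2 - d); [|easy].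
    apply Zint; [lra|]. intros; apply Z2; lra. }
  assert (T : is_RInt (fun x => w x * Derive_n phi 2 x + k ^ 2 * w x * phi x) y1 y2 (A1 - A2)).
  { replace (A1 - A2) with (minus (plus A1 0) (plus 0 A2))
      by (unfold minus, plus, opp; simpl; ring).
    apply (is_RInt_ext (fun x => minus (F r1 x) (F r2 x))).
    - intros x _. rewrite Dphi. unfold F, minus, plus, opp; simpl; ring.
    - now apply (is_RInt_minus (V := R_NormedModule)). }
  assert (E : A1 - A2 = - (s * phi x0)).
  { rewrite <- (is_RInt_unique _ _ _ _ T). apply is_RInt_unique, weak; [easy|].
    intros x Hx. unfold phi.
    destruct (Rlt_dec x y1) as [Hl|Hl].
    - rewrite L1, L2 by lra. ring.
    - rewrite U1, U2 by lra. ring. }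
  (* By [F1] and [F2] the source is on neither ramp, so the cutoff is 0 or 1 there. *)
  assert (Ephi : phi x0 = chi_Ioc y1 y2 x0 * v x0).
  { unfold phi, chi_Ioc. destruct (Rlt_dec y1 x0); [destruct (Rle_dec x0 y2)|].
    - rewrite U1, L2 by lra. ring.
    - rewrite U1, U2 by lra. ring.
    - rewrite L1, L2 by lra. ring. }
  assert (B1 : Rabs (A1 - W y1) <= e).
  { apply ramp_average; try easy; [lra|apply L1; lra|apply U1; lra| |].
    - intros; apply wronskian_cont; now apply N1'.
    - intros; now apply N1'. }
  assert (B2 : Rabs (A2 - W y2) <= e).
  { apply ramp_average; try easy; [lra|apply L2; lra|apply U2; lra| |].
    - intros; apply wronskian_cont; now apply N2'.
    - intros; now apply N2'. }
  rewrite <- Ephi. apply Rabs_le_between in B1. apply Rabs_le_between in B2.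
  apply Rabs_le. lra.
Qed.

End Wronskian.

(** * Admissible wave speeds as layered media *)

(** The medium to the right of the jump point [X j], with [m] further jumps ahead. *)
Fixpoint stack (X V : nat -> R) (j m : nat) : medium :=
  match m with
  | O => Half (V j)
  | S m => Layer (V j) (X (S j) - X j) (stack X V (S j) m)
  end.

Lemma wf_stack (X V : nat -> R) (j m : nat) :
  (forall i, (j <= i)%nat -> (i < j + m)%nat -> X i < X (S i)) ->
  (forall i, (j <= i)%nat -> (i <= j + m)%nat -> 0 < V i) -> wf (stack X V j m).
Proof.
  revert j; induction m as [|m IH]; intros j HX HV; simpl.
  - apply HV; lia.
  - repeat split; [apply HV; lia| |].
    + specialize (HX j ltac:(lia) ltac:(lia)). lra.
    + apply IH; intros; [apply HX|apply HV]; lia.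
Qed.

Lemma terminal_stack (X V : nat -> R) (j m : nat) : terminal (stack X V j m) = V (j + m)%nat.
Proof.
  revert j; induction m as [|m IH]; intros j; simpl; [f_equal; lia|].
  rewrite IH. f_equal; lia.
Qed.

Definition tail_speed (X V : nat -> R) (j m : nat) (x : R) : R :=
  sum_n_m (fun i => V i * chi_Ioc (X i) (X (S i)) x) j (j + m - 1)
  + V (j + m)%nat * chi_gt (X (j + m)%nat) x.

(** The sum runs from [j] to [j - 1] and is empty; for [j = 0] truncated subtraction would leave the
    term of index 0. *)
Lemma tail_speed_0 (X V : nat -> R) (j : nat) (x : R) : (1 <= j)%nat ->
  tail_speed X V j 0 x = V j * chi_gt (X j) x.
Proof.
  intros Hj; unfold tail_speed. rewrite sum_n_m_zero by lia.
  replace (j + 0)%nat with j by lia. unfold zero; simpl; ring.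
Qed.

Lemma tail_speed_S (X V : nat -> R) (j m : nat) (x : R) :
  tail_speed X V j (S m) x = V j * chi_Ioc (X j) (X (S j)) x + tail_speed X V (S j) m x.
Proof.
  unfold tail_speed. rewrite sum_Sn_m by lia.
  replace (j + S m - 1)%nat with (S j + m - 1)%nat by lia.
  replace (j + S m)%nat with (S j + m)%nat by lia.
  unfold plus; simpl; ring.
Qed.

Lemma tail_speed_left (X V : nat -> R) (j m : nat) (x : R) : (1 <= j)%nat ->
  (forall i, (j <= i)%nat -> (i < j + m)%nat -> X i < X (S i)) ->
  x <= X j -> tail_speed X V j m x = 0.
Proof.
  revert j; induction m as [|m IH]; intros j Hj HX Hx.
  - rewrite tail_speed_0 by easy. unfold chi_gt. destruct (Rlt_dec (X j) x); lra.
  - rewrite tail_speed_S, IH; [|lia|intros; apply HX; lia|].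
    + unfold chi_Ioc. destruct (Rlt_dec (X j) x); lra.
    + specialize (HX j ltac:(lia) ltac:(lia)). lra.
Qed.

Lemma mspeed_stack (X V : nat -> R) (j m : nat) (x : R) : (1 <= j)%nat ->
  (forall i, (j <= i)%nat -> (i < j + m)%nat -> X i < X (S i)) ->
  X j < x -> mspeed (X j) (stack X V j m) x = tail_speed X V j m x.
Proof.
  revert j; induction m as [|m IH]; intros j Hj HX Hx.
  - rewrite tail_speed_0 by easy. unfold chi_gt; simpl. destruct (Rlt_dec (X j) x); lra.
  - rewrite tail_speed_S. simpl. replace (X j + (X (S j) - X j)) with (X (S j)) by ring.
    unfold chi_Ioc. destruct (Rlt_dec (X j) x); [|lra].
    destruct (Rle_dec x (X (S j))).
    + rewrite tail_speed_left; [ring|lia|intros; apply HX; lia|easy].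
    + rewrite IH; [ring|lia|intros; apply HX; lia|lra].
Qed.

Lemma speed_medium (c0 x0 xs : R) (c : wave_speed c0 x0 xs) : 0 < c0 ->
  exists M, wf M /\ terminal M = ws_c c (ws_n c)
    /\ (forall x, x <= xs -> speed c x = c0)
    /\ (forall x, xs < x -> speed c x = mspeed xs M x).
Proof.
  intros Hc0. destruct c as [n X V Hn HX1 HXi HV]; simpl.
  assert (E : forall x, speed (Build_wave_speed c0 x0 xs n X V Hn HX1 HXi HV) x
                = c0 * chi_le (X 1%nat) x + tail_speed X V 1 (n - 1) x).
  { intros x. unfold speed, tail_speed; simpl ws_n; simpl ws_x; simpl ws_c.
    replace (1 + (n - 1) - 1)%nat with (n - 1)%nat by lia.
    replace (1 + (n - 1))%nat with n by lia. apply Rplus_assoc. }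
  (* The medium begins at the receiver, so its first layer is the stretch of known speed up to the
     first jump. *)
  exists (Layer c0 (X 1%nat - xs) (stack X V 1 (n - 1))).
  assert (Hinc : forall i, (1 <= i)%nat -> (i < 1 + (n - 1))%nat -> X i < X (S i))
    by (intros; apply HXi; lia).
  repeat split; [easy|lra| | | |].
  - apply wf_stack; [easy|intros; apply HV; lia].
  - simpl. rewrite terminal_stack. f_equal; lia.
  - intros x Hx. rewrite E, tail_speed_left by (easy || lia || lra).
    unfold chi_le. destruct (Rle_dec x (X 1%nat)); lra.
  - intros x Hx. rewrite E. simpl. replace (xs + (X 1%nat - xs)) with (X 1%nat) by ring.
    unfold chi_le. destruct (Rle_dec x (X 1%nat)).
    + rewrite tail_speed_left by (easy || lia || lra). ring.
    + rewrite mspeed_stack by (easy || lia || lra). ring.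
Qed.

(** * Propagation of the outgoing solution *)

Lemma is_derive_fst (f : R -> C) (x : R) (l : C) :
  is_derive (V := C_R_NormedModule) f x l -> is_derive (fun t => fst (f t)) x (fst l).
Proof.
  intros H.
  pose proof (filterdiff_comp' (U := R_NormedModule) (V := C_R_NormedModule)
    (W := R_NormedModule) f (fun z : C => fst z) x _ _ H
    (filterdiff_linear (U := C_R_NormedModule) (V := R_NormedModule) _ is_linear_fst)) as D.
  exact D.
Qed.

Lemma is_derive_snd (f : R -> C) (x : R) (l : C) :
  is_derive (V := C_R_NormedModule) f x l -> is_derive (fun t => snd (f t)) x (snd l).
Proof.
  intros H.
  pose proof (filterdiff_comp' (U := R_NormedModule) (V := C_R_NormedModule)
    (W := R_NormedModule) f (fun z : C => snd z) x _ _ H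
    (filterdiff_linear (U := C_R_NormedModule) (V := R_NormedModule) _ is_linear_snd)) as D.
  exact D.
Qed.

Lemma continuous_Cfst (f : R -> C) (x : R) :
  continuous (U := C_R_NormedModule) f x -> continuous (fun t => fst (f t)) x.
Proof.
  intros H.
  apply (continuous_comp (V := C_R_NormedModule) (W := R_UniformSpace) f (fun z : C => fst z)).
  - exact H.
  - apply (continuous_fst (U := R_UniformSpace) (V := R_UniformSpace)).
Qed.

Lemma continuous_Csnd (f : R -> C) (x : R) :
  continuous (U := C_R_NormedModule) f x -> continuous (fun t => snd (f t)) x.
Proof.
  intros H.
  apply (continuous_comp (V := C_R_NormedModule) (W := R_UniformSpace) f (fun z : C => snd z)).
  - exact H.
  - apply (continuous_snd (U := R_UniformSpace) (V := R_UniformSpace)).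
Qed.

(** * Plane waves, and the real and imaginary parts of the weak equation *)

Lemma Cexpi_add (s t : R) : Cexpi (s + t) = (Cexpi s * Cexpi t)%C.
Proof.
  unfold Cexpi, Cmult; simpl. rewrite cos_plus, sin_plus. f_equal; ring.
Qed.

Lemma Cexpi_0 : Cexpi 0 = 1%C.
Proof. unfold Cexpi. now rewrite cos_0, sin_0. Qed.

Lemma Cexpi_neq_0 (t : R) : Cexpi t <> 0%C.
Proof.
  intros H. apply C1_nz. rewrite <- Cexpi_0, <- (Rplus_opp_r t), Cexpi_add, H, Rplus_opp_r. ring.
Qed.

Lemma Ci_neq_0 : Ci <> 0%C.
Proof. intros H. injection H; lra. Qed.

Lemma plane_wave_derive (u : R -> C) (A d : C) (k x : R) :
  locally x (fun t => u t = (A * Cexpi (k * t))%C) ->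
  is_derive (V := C_R_NormedModule) u x d -> d = (Ci * k * u x)%C.
Proof.
  intros H D. destruct A as [a b].
  assert (D1 : is_derive (fun t => fst (u t)) x (- k * (a * sin (k * x) + b * cos (k * x)))).
  { apply (is_derive_ext_loc (fun t => a * cos (k * t) - b * sin (k * t))).
    - apply (filter_imp (fun t => u t = ((a, b) * Cexpi (k * t))%C)); [|easy].
      intros t Ht. now rewrite Ht.
    - auto_derive; [easy|ring]. }
  assert (D2 : is_derive (fun t => snd (u t)) x (k * (a * cos (k * x) - b * sin (k * x)))).
  { apply (is_derive_ext_loc (fun t => a * sin (k * t) + b * cos (k * t))).
    - apply (filter_imp (fun t => u t = ((a, b) * Cexpi (k * t))%C)); [|easy].
      intros t Ht. now rewrite Ht.
    - auto_derive; [easy|ring]. }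
  apply is_derive_unique in D1. apply is_derive_unique in D2.
  pose proof (is_derive_unique _ _ _ (is_derive_fst _ _ _ D)) as E1.
  pose proof (is_derive_unique _ _ _ (is_derive_snd _ _ _ D)) as E2.
  apply locally_singleton in H. rewrite H.
  destruct d as [d1 d2]; simpl in E1, E2.
  unfold Cmult, Cexpi, Ci, RtoC; simpl. f_equal.
  - rewrite <- E1. etransitivity; [exact D1|ring].
  - rewrite <- E2. etransitivity; [exact D2|ring].
Qed.

(** The source is real, so it appears in the first component only. The speed at the end points does
    not affect the integral. *)
Lemma helmholtz_components (sp : R -> R) (x0 omega k c y1 y2 : R) (u : R -> C) :
  y1 < y2 -> helmholtz_source sp x0 omega u ->
  (forall x, y1 < x < y2 -> sp x = c) -> k ^ 2 = (omega / c) ^ 2 ->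
  forall phi, smooth phi -> (forall x, ~ (y1 <= x <= y2) -> phi x = 0) ->
  is_RInt (fun x => fst (u x) * Derive_n phi 2 x + k ^ 2 * fst (u x) * phi x)
    y1 y2 (- phi x0)
  /\ is_RInt (fun x => snd (u x) * Derive_n phi 2 x + k ^ 2 * snd (u x) * phi x) y1 y2 0.
Proof.
  intros Hy Hs Hc Hk phi Sphi Zphi.
  specialize (Hs phi y1 y2 Hy Sphi Zphi). split.
  - pose proof (is_RInt_fct_extend_fst (U := R_NormedModule) (V := R_NormedModule) _ _ _ _ Hs) as H.
    apply (is_RInt_ext_open _ _ _ _ _ (Rlt_le _ _ Hy)) with (2 := H).
    intros x Hx. rewrite (Hc x Hx), Hk. unfold Cmult, Cplus, RtoC; simpl. ring.
  - pose proof (is_RInt_fct_extend_snd (U := R_NormedModule) (V := R_NormedModule) _ _ _ _ Hs) as H.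
    apply (is_RInt_ext_open _ _ _ _ _ (Rlt_le _ _ Hy)) with (2 := H).
    intros x Hx. rewrite (Hc x Hx), Hk. unfold Cmult, Cplus, RtoC; simpl. ring.
Qed.

Section Transfer.

Variables (sp : R -> R) (x0 omega : R) (u du : R -> C).
Hypothesis u_cont : forall x, continuous (U := C_R_NormedModule) u x.
Hypothesis u_derive : forall x, x <> x0 ->
  is_derive (V := C_R_NormedModule) u x (du x) /\ continuous (U := C_R_NormedModule) du x.
Hypothesis u_source : helmholtz_source sp x0 omega u.

(* The two signs of k give the right- and the left-going wave. *)
Lemma transfer (c k y1 y2 : R) : y1 < y2 -> y1 <> x0 -> y2 <> x0 ->
  (forall x, y1 < x < y2 -> sp x = c) -> k ^ 2 = (omega / c) ^ 2 ->
  ((du y2 + Ci * k * u y2) * Cexpi (- (k * y2))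
   = (du y1 + Ci * k * u y1) * Cexpi (- (k * y1))
     - chi_Ioc y1 y2 x0 * Cexpi (- (k * x0)))%C.
Proof.
  intros Hy H1 H2 Hc Hk.
  pose proof (helmholtz_components sp x0 omega k c y1 y2 u Hy u_source Hc Hk) as weak.
  assert (Dcos : forall x, is_derive (fun x => cos (k * x)) x (- k * sin (k * x)))
    by (intros; auto_derive; [easy|ring]).
  assert (Dcos' : forall x, is_derive (fun x => - k * sin (k * x)) x (- k ^ 2 * cos (k * x)))
    by (intros; auto_derive; [easy|ring]).
  assert (Dsin : forall x, is_derive (fun x => sin (k * x)) x (k * cos (k * x)))
    by (intros; auto_derive; [easy|ring]).
  assert (Dsin' : forall x, is_derive (fun x => k * cos (k * x)) x (- k ^ 2 * sin (k * x)))
    by (intros; auto_derive; [easy|ring]).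
  assert (Ja : forall v dv, (forall x, is_derive v x (dv x)) ->
    (forall x, is_derive dv x (- k ^ 2 * v x)) ->
    (fst (u y2) * dv y2 - fst (du y2) * v y2) - (fst (u y1) * dv y1 - fst (du y1) * v y1)
    = chi_Ioc y1 y2 x0 * v x0).
  { intros v dv Hv Hdv.
    rewrite <- (Rmult_1_l (chi_Ioc y1 y2 x0 * v x0)).
    apply (wronskian_jump x0 k 1 (fun x => fst (u x)) (fun x => fst (du x))); try easy.
    - intros; now apply continuous_Cfst.
    - intros; now apply is_derive_fst, u_derive.
    - intros; now apply continuous_Cfst, u_derive.
    - intros phi S Z. rewrite Rmult_1_l. now apply weak. }
  assert (Jb : forall v dv, (forall x, is_derive v x (dv x)) ->
    (forall x, is_derive dv x (- k ^ 2 * v x)) ->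
    (snd (u y2) * dv y2 - snd (du y2) * v y2) - (snd (u y1) * dv y1 - snd (du y1) * v y1)
    = 0).
  { intros v dv Hv Hdv.
    rewrite <- (Rmult_0_l (chi_Ioc y1 y2 x0 * v x0)).
    apply (wronskian_jump x0 k 0 (fun x => snd (u x)) (fun x => snd (du x))); try easy.
    - intros; now apply continuous_Csnd.
    - intros; now apply is_derive_snd, u_derive.
    - intros; now apply continuous_Csnd, u_derive.
    - intros phi S Z. rewrite Rmult_0_l, Ropp_0. now apply weak. }
  (* The four real identities are the components of the Wronskian identity for [Cexpi (- (k * x))],
     whose Wronskian with u is - (u' + i k u) e^(-i k x). *)
  pose proof (Ja _ _ Dcos Dcos') as A1. pose proof (Ja _ _ Dsin Dsin') as A2.
  pose proof (Jb _ _ Dcos Dcos') as B1. pose proof (Jb _ _ Dsin Dsin') as B2.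
  cbv beta in *. unfold Cexpi. rewrite !cos_neg, !sin_neg.
  destruct (u y1) as [a1 b1], (u y2) as [a2 b2], (du y1) as [a1' b1'], (du y2) as [a2' b2'].
  unfold Cminus, Copp, Cplus, Cmult, Ci, RtoC; simpl in *. f_equal; lra.
Qed.

(** To the right of the source no jump occurs, and [transfer] can be solved for the left end. *)
Lemma transfer_right (c k y1 y2 : R) : y1 < y2 -> x0 < y1 ->
  (forall x, y1 < x < y2 -> sp x = c) -> k ^ 2 = (omega / c) ^ 2 ->
  (du y1 + Ci * k * u y1 = (du y2 + Ci * k * u y2) * Cexpi (- (k * (y2 - y1))))%C.
Proof.
  intros Hy H1 Hc Hk.
  pose proof (transfer c k y1 y2 Hy ltac:(lra) ltac:(lra) Hc Hk) as T.
  replace (chi_Ioc y1 y2 x0) with 0 in T by (unfold chi_Ioc; destruct (Rlt_dec y1 x0); lra).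
  replace (- (k * (y2 - y1))) with (- (k * y2) + k * y1) by ring.
  rewrite Cexpi_add, Cmult_assoc, T.
  transitivity ((du y1 + Ci * k * u y1) * (Cexpi (- (k * y1)) * Cexpi (k * y1)))%C; [|ring].
  rewrite <- Cexpi_add, Rplus_opp_l, Cexpi_0. ring.
Qed.

(** The state is carried leftwards from the outer half-line, one layer at a time; [B] is the common
    factor that [state] leaves open. *)
Lemma outgoing_state (M : medium) : omega <> 0 -> wf M -> forall y, x0 < y ->
  (forall x, y < x -> sp x = mspeed y M x) ->
  (exists (B : C) (X : R), forall x, X < x -> u x = (B * Cexpi (omega * x / terminal M))%C) ->
  exists B : C, u y = (B * evc omega (fst (state M)))%C
         /\ du y = (B * (Ci * omega * evc omega (snd (state M))))%C.
Proof.
  intros Hom. induction M as [c|c d M IH]; intros HM y Hy Hsp Hrad; simpl in HM.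
  - exists (u y). simpl in Hsp, Hrad. destruct Hrad as (B & X & Hrad).
    (* A point where the radiation condition holds. There u' - i k u = 0, and [transfer_right] with
       [- k] brings this back to [y]. *)
    set (z := Rmax y X + 1).
    assert (Hz : y < z /\ X < z)
      by (unfold z; pose proof (Rmax_l y X); pose proof (Rmax_r y X); lra).
    set (k := omega / c).
    assert (Dz : du z = (Ci * k * u z)%C).
    { apply (plane_wave_derive u B (du z) k z); [|apply u_derive; lra].
      apply (filter_imp (fun t => X < t)); [|now apply open_gt].
      intros t Ht. rewrite Hrad by easy. unfold k. do 2 f_equal. field; lra. }
    pose proof (transfer_right c (- k) y z ltac:(lra) Hy
      ltac:(intros; apply Hsp; lra) ltac:(unfold k; ring)) as T.
    rewrite Dz, RtoC_opp in T.
    replace (Ci * k * u z + Ci * - k * u z)%C with (RtoC 0) in T by ring.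
    rewrite Cmult_0_l in T.
    assert (Dy : du y = (Ci * k * u y)%C).
    { transitivity ((du y + Ci * - k * u y) + Ci * k * u y)%C; [ring|]. rewrite T. ring. }
    assert (E1 : evc omega (fst (state (Half c))) = 1%C).
    { unfold evc; simpl. rewrite Rmult_0_r, cos_0, sin_0. unfold RtoC. f_equal; ring. }
    assert (E2 : evc omega (snd (state (Half c))) = RtoC (/ c)).
    { unfold evc; simpl. rewrite Rmult_0_r, cos_0, sin_0. unfold RtoC. f_equal; ring. }
    rewrite E1, E2. split; [ring|]. rewrite Dy. unfold k, Rdiv. rewrite RtoC_mult. ring.
  - destruct HM as (Hc & Hd & HM).
    destruct (IH HM (y + d)) as (B & Eu & Edu); [lra| |easy|].
    { intros x Hx. rewrite Hsp by lra. simpl. destruct (Rle_dec x (y + d)); [lra|easy]. }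
    exists B. set (k := omega / c).
    assert (Hlayer : forall x, y < x < y + d -> sp x = c).
    { intros x Hx. rewrite Hsp by lra. simpl. destruct (Rle_dec x (y + d)); [easy|lra]. }
    pose proof (transfer_right c k y (y + d) ltac:(lra) Hy Hlayer eq_refl) as T1.
    pose proof (transfer_right c (- k) y (y + d) ltac:(lra) Hy Hlayer
      ltac:(unfold k; ring)) as T2.
    rewrite Eu, Edu in T1, T2. simpl.
    destruct (state M) as [P Q]; cbn [fst snd] in *.
    rewrite !evc_escale, !evc_app, !evc_escale, !evc_eshift, !evc_app, !evc_escale.
    replace (omega * - (d / c)) with (- (k * (y + d - y))) by (unfold k; field; lra).
    replace (omega * (d / c)) with (- (- k * (y + d - y))) by (unfold k; field; lra).
    set (e1 := Cexpi (- (k * (y + d - y)))) in *.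
    set (e2 := Cexpi (- (- k * (y + d - y)))) in *.
    assert (Hk : RtoC omega = (k * c)%C).
    { rewrite <- RtoC_mult. f_equal. unfold k; field; lra. }
    assert (Hk0 : RtoC k <> 0%C).
    { intros H. apply Hom. apply RtoC_inj. rewrite Hk, H. ring. }
    assert (Hc0 : RtoC c <> 0%C) by (intros H; apply RtoC_inj in H; lra).
    assert (H2 : RtoC 2 <> 0%C) by (intros H; apply RtoC_inj in H; lra).
    rewrite !RtoC_inv, RtoC_mult, !RtoC_opp by lra. rewrite RtoC_opp in T2.
    pose proof Ci_neq_0 as Hi.
    rewrite Hk in T1, T2 |- *.
    split.
    (* The transfers [T1] and [T2] give u' + i k u and u' - i k u at [y]; their difference yields u,
       their sum u'. *)
    + transitivity (((du y + Ci * k * u y) - (du y + Ci * - k * u y)) / (2 * Ci * k))%C.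
      * field. auto.
      * rewrite T1, T2. field. auto.
    + transitivity (((du y + Ci * k * u y) + (du y + Ci * - k * u y)) / 2)%C.
      * field. auto.
      * rewrite T1, T2. field. auto.
Qed.

(* The field to the left of the source is a pure left-going wave, so [u]
   determines [u'] between the source and the first jump. *)
Lemma source_relation (c0 xs : R) : x0 < xs ->
  (forall x, x < xs -> sp x = c0) ->
  (exists A : C, forall x, x < x0 -> u x = (A * Cexpi (- (omega * x / c0)))%C) -> c0 <> 0 ->
  (du xs + Ci * (omega / c0)%R * u xs = - Cexpi (omega / c0 * (xs - x0)))%C.
Proof.
  intros Hxs Hsp [A HA] Hc0. set (k := omega / c0).
  (* Any point to the left of the source serves: u' + i k u vanishes there, and only the source term
     survives. *)
  pose proof (transfer c0 k (x0 - 1) xs ltac:(lra) ltac:(lra) ltac:(lra)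
    ltac:(intros; apply Hsp; lra) eq_refl) as T.
  assert (D : du (x0 - 1) = (Ci * (- k)%R * u (x0 - 1)%R)%C).
  { apply (plane_wave_derive u A _ (- k) (x0 - 1)); [|apply u_derive; lra].
    apply (filter_imp (fun t => t < x0)); [|apply open_lt; lra].
    intros t Ht. rewrite HA by easy. unfold k. do 2 f_equal. field; easy. }
  rewrite D, RtoC_opp in T.
  replace (chi_Ioc (x0 - 1) xs x0) with 1 in T
    by (unfold chi_Ioc; destruct (Rlt_dec (x0 - 1) x0), (Rle_dec x0 xs); lra).
  replace (k * (xs - x0)) with (- (k * x0) + k * xs) by ring.
  rewrite Cexpi_add.
  transitivity ((du xs + Ci * k * u xs) * (Cexpi (- (k * xs)) * Cexpi (k * xs)))%C.
  - rewrite <- Cexpi_add, Rplus_opp_l, Cexpi_0. ring.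
  - rewrite Cmult_assoc, T. ring.
Qed.

End Transfer.

(** The left side of the last equation is u' at the receiver, expressed through the datum alone. The
    factor [B] is nonzero, since otherwise u and u' would both vanish at [xs], against
    [source_relation]. *)
Lemma outgoing_data (c0 x0 xs omega : R) (c : wave_speed c0 x0 xs) (u : R -> C) (M : medium) :
  0 < c0 -> x0 < xs -> omega <> 0 -> outgoing_solution c omega u ->
  wf M -> terminal M = ws_c c (ws_n c) ->
  (forall x, x <= xs -> speed c x = c0) -> (forall x, xs < x -> speed c x = mspeed xs M x) ->
  exists B : C, B <> 0%C /\ u xs = (B * evc omega (fst (state M)))%C
    /\ (- Cexpi (omega / c0 * (xs - x0)) - Ci * (omega / c0)%R * u xs
        = B * (Ci * omega * evc omega (snd (state M))))%C.
Proof.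
  intros Hc0 Hxs Hom (Hcont & [du Hdu] & Hsrc & HL & [B0 HR]) HM Ht Hl Hr.
  pose proof (source_relation (speed c) x0 omega u du Hcont Hdu Hsrc c0 xs Hxs
    ltac:(intros; apply Hl; lra) HL ltac:(lra)) as S.
  destruct (outgoing_state (speed c) x0 omega u du Hcont Hdu Hsrc M Hom HM xs Hxs Hr)
    as (B & Eu & Edu).
  { exists B0, (ws_x c (ws_n c)). now rewrite Ht. }
  exists B. repeat split; [|easy|].
  - intros ->. apply (Cexpi_neq_0 (omega / c0 * (xs - x0))).
    rewrite Eu, Edu in S.
    transitivity (- - Cexpi (omega / c0 * (xs - x0)))%C; [ring|]. rewrite <- S. ring.
  - rewrite <- Edu, <- S. ring.
Qed.

Theorem theorem2 (c0 x0 xs omega_min omega_max : R)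
    (hc0 : 0 < c0) (hxs : x0 < xs) (homega : omega_min < omega_max)
    (c c' : wave_speed c0 x0 xs)
    (u u' : R -> R -> C)
    (hu : forall omega : R, omega <> 0 ->
      outgoing_solution c omega (fun x : R => u x omega))
    (hu' : forall omega : R, omega <> 0 ->
      outgoing_solution c' omega (fun x : R => u' x omega))
    (hdata : forall omega : R, omega_min < omega < omega_max -> omega <> 0 ->
      u xs omega = u' xs omega) :
  speed c = speed c'.
Proof.
  destruct (speed_medium c0 x0 xs c hc0) as (M & HM & HT & HL & HR).
  destruct (speed_medium c0 x0 xs c' hc0) as (M' & HM' & HT' & HL' & HR').
  set (P := fst (state M)). set (Q := snd (state M)).
  set (P' := fst (state M')). set (Q' := snd (state M')).
  (* The formal sum P Q' - Q P'. *)
  set (L := emul P Q' ++ escale (-1) (emul Q P')).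
  assert (Hev : forall w, omega_min < w < omega_max -> w <> 0 -> evc w L = 0%C).
  { intros w Hw Hw0.
    destruct (outgoing_data c0 x0 xs w c _ M hc0 hxs Hw0 (hu w Hw0) HM HT HL HR)
      as (B & HB & E1 & E2).
    destruct (outgoing_data c0 x0 xs w c' _ M' hc0 hxs Hw0 (hu' w Hw0) HM' HT' HL' HR')
      as (B' & HB' & E1' & E2').
    rewrite (hdata w Hw Hw0) in E1, E2. rewrite E2' in E2. rewrite E1' in E1.
    fold P Q in E1, E2. fold P' Q' in E1, E2.
    unfold L. rewrite evc_app, evc_escale, !evc_emul.
    assert (Hiw : (Ci * w)%C <> 0%C).
    { apply Cmult_neq_0; [apply Ci_neq_0|]. intros H; apply RtoC_inj in H; easy. }
    (* Equal data make the two pairs (u, u') at the receiver equal, so their cross product vanishes;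
       the prefactor is nonzero and can be divided out. *)
    assert (Z : (B * B' * (Ci * w) * (evc w P * evc w Q' + (-1)%R * (evc w Q * evc w P')) = 0)%C).
    { transitivity ((B * evc w P) * (B' * (Ci * w * evc w Q'))
                    - (B' * evc w P') * (B * (Ci * w * evc w Q)))%C.
      - rewrite (RtoC_opp 1 : RtoC (-1) = (- (1))%C). ring.
      - rewrite <- E1, E2. ring. }
    destruct (Ceq_dec (evc w P * evc w Q' + (-1)%R * (evc w Q * evc w P'))%C 0%C)
      as [E|E]; [easy|].
    exfalso; revert Z. apply Cmult_neq_0; [|easy].
    apply Cmult_neq_0; [now apply Cmult_neq_0|easy]. }
  assert (HS : same_response M M').
  { intros s _.
    assert (H : ev (lap s) L = 0).
    { destruct (Rle_dec 0 omega_min) as [H0|H0].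
      - apply (ev_zero omega_min omega_max); [easy|]. intros; apply Hev; lra.
      - apply (ev_zero omega_min (Rmin 0 omega_max)); [apply Rmin_glb_lt; lra|].
        intros w Hw. pose proof (Rmin_l 0 omega_max). pose proof (Rmin_r 0 omega_max).
        apply Hev; lra. }
    unfold L in H. rewrite ev_app, ev_escale, !ev_emul in H by apply lap_add.
    unfold lp, lq. fold P Q P' Q'. lra. }
  apply functional_extensionality; intros x.
  destruct (Rle_dec x xs) as [Hx|Hx].
  - now rewrite HL, HL'.
  - rewrite HR, HR' by lra. now apply response_inj.
Qed.
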